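(* Let $G=(V,E)$ be a finite connected graph (multiple edges and loops allowed). Then the rational function \[ \omega_G(\beta):=\frac{\theta_G(\beta,\sqrt{-1})}{(1-\beta)^{|E|-|V|}} \] is a polynomial in $\beta$ with integer coefficients, i.e. $\omega_G\in\mathbb{Z}[\beta]$.
   Context: The polynomials $f_n$ are defined by $f_0(x)=1$, $f_1(x)=0$, $f_{n+1}(x)=xf_n(x)+f_{n-1}(x)$. For a finite graph $G=(V,E)$, $\theta_G(\beta,\xi)=\sum_{s\subset E}\beta^{|s|}\prod_{i\in V}f_{d_i(s)}(\xi-\xi^{-1})$, where $d_i(s)$ is the degree of node $i$ in the subgraph with edge set $s$ (a loop contributes $2$). $\theta_G(\beta,\sqrt{-1})$ denotes the polynomial in $\beta$ obtained by substituting $\xi=\sqrt{-1}$, so that $\xi-\xi^{-1}=2\sqrt{-1}$. *)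

(* Defs.v *)
From HB Require Import structures.
From mathcomp Require Import all_boot all_order all_algebra.

Set Implicit Arguments.
Unset Strict Implicit.
Unset Printing Implicit Defensive.

Import Order.TTheory GRing.Theory Num.Theory.
Local Open Scope ring_scope.

(* Finite undirected graphs with multiple edges and loops. The order of the
   two ends of an edge carries no meaning: [degree] and [adjacent] below are
   invariant under swapping them. *)
Record multigraph := Multigraph {
  vertex : finType;
  edge : finType;
  ends : edge -> vertex * vertex
}.

(* A loop at i in s is counted twice. *)
Definition degree (G : multigraph) (s : {set edge G}) (i : vertex G) : nat :=
  (\sum_(e in s) (((ends e).1 == i) + ((ends e).2 == i)))%N.

Definition adjacent (G : multigraph) : rel (vertex G) :=
  fun u v => [exists e : edge G, (ends e == (u, v)) || (ends e == (v, u))].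

(* The empty graph is not connected. *)
Definition connected_graph (G : multigraph) : Prop :=
  (0 < #|vertex G|)%N /\ forall u v : vertex G, connect (@adjacent G) u v.

Fixpoint fpoly (R : comNzRingType) (n : nat) {struct n} : {poly R} :=
  match n with
  | 0%N => 1
  | n1.+1 => match n1 with
             | 0%N => 0
             | n2.+1 => 'X * fpoly R n1 + fpoly R n2
             end
  end.

(* The formal variable 'X is beta. *)
Definition theta (K : fieldType) (G : multigraph) (xi : K) : {poly K} :=
  \sum_(s : {set edge G})
     (\prod_(i : vertex G) (fpoly K (degree s i)).[xi - xi^-1]) *: 'X^#|s|.

(* The exponent #|E| - #|V| is an integer, equal to -1 for trees. *)
Definition omega (C : numClosedFieldType) (G : multigraph) :
    {fraction {poly C}} :=
  tofrac (theta G ('i : C))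
    / tofrac (1 - 'X) ^ ((#|edge G|)%:Z - (#|vertex G|)%:Z).

(* Main.v *)
Require Import Defs.
From HB Require Import structures.
From mathcomp Require Import all_boot all_order all_algebra.
From mathcomp Require Import ring.

(** At [xi = 'i] the recurrence for [f_n] has the double root ['i], so
    [f_n (2 'i) = (1 - n) 'i ^ n]; since the degrees in [s] add up to [2 |s|],
    [theta = \sum_s (- X) ^ |s| \prod_v (1 - d_v(s))].  Expand each factor
    [1 - d_v(s)] as a sum over "nothing" or an edge of [s] at [v].  A term of
    the resulting product prescribes a set [U] of at most [|V|] edges, and
    summing [(- X) ^ |s|] over all [s] containing [U] gives
    [(- X) ^ |U| (1 - X) ^ (|E| - |U|)], a multiple of
    [(1 - X) ^ (|E| - |V|)]. *)

Set Implicit Arguments.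
Unset Strict Implicit.
Unset Printing Implicit Defensive.

Import Order.TTheory GRing.Theory Num.Theory.
Local Open Scope ring_scope.

Lemma fpoly_horner_2i (C : numClosedFieldType) (n : nat) :
  (fpoly C n).['i - 'i^-1] = (1 - n%:R) * 'i ^+ n.
Proof.
have fSS m : fpoly C m.+2 = 'X * fpoly C m.+1 + fpoly C m by [].
have i2 : 'i * 'i = -1 :> C by rewrite -expr2 sqrCi.
suff [] : (fpoly C n).['i - 'i^-1] = (1 - n%:R) * 'i ^+ n /\
  (fpoly C n.+1).['i - 'i^-1] = (1 - n.+1%:R) * 'i ^+ n.+1 by [].
elim: n => [|n [IH0 IH1]].
  by rewrite /= hornerC horner0 subrr mul0r subr0 mulr1.
split=> //; rewrite fSS hornerD hornerM hornerX IH0 IH1 invCi opprK.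
rewrite !exprS -!natr1; set a := 'i ^+ n.
(* Both sides are regrouped around ['i * 'i], since [ring] does not know that it equals -1. *)
have -> : ('i + 'i) * ((1 - (n%:R + 1)) * ('i * a)) + (1 - n%:R) * a
  = (('i * 'i) * (- n%:R *+ 2) + (1 - n%:R)) * a :> C by ring.
have -> : (1 - (n%:R + 1 + 1)) * ('i * ('i * a))
  = ('i * 'i) * (- n%:R - 1) * a :> C by ring.
by rewrite i2; ring.
Qed.

Lemma sum_degree (G : multigraph) (s : {set edge G}) :
  (\sum_(i : vertex G) degree s i = #|s| * 2)%N.
Proof.
rewrite exchange_big -sum_nat_const; apply: eq_bigr => e _ /=.
have sum1 (x : vertex G) : (\sum_i (x == i) = 1)%N.
  by rewrite (bigD1 x) //= eqxx big1 // => i /negPf; rewrite eq_sym => ->.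
by rewrite big_split /= !sum1.
Qed.

(** The sign ['i ^ (2 |s|)] is absorbed into [- 'X]. Dividing already over [int] makes the quotient
    integral. *)
Definition int_theta (G : multigraph) : {poly int} :=
  \sum_(s : {set edge G})
     (\prod_(i : vertex G) (1 - (degree s i)%:R)) * (- 'X) ^+ #|s|.

Lemma theta_i_int (C : numClosedFieldType) (G : multigraph) :
  theta G ('i : C) = map_poly intr (int_theta G).
Proof.
rewrite /int_theta rmorph_sum; apply: eq_bigr => s _ /=.
rewrite rmorphM rmorphXn rmorphN /= map_polyX rmorph_prod.
under eq_bigr => i _ do rewrite fpoly_horner_2i.
rewrite big_split prodrXr /= sum_degree mulnC exprM sqrCi.
rewrite -mul_polyC rmorphM rmorphXn rmorphN rmorph1 -mulrA -exprMn mulN1r.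
rewrite rmorph_prod; congr (_ * _); apply: eq_bigr => i _.
by rewrite !rmorphB !rmorph1 !rmorph_nat.
Qed.

(** Each element of [U] must be taken and gives [x]; any other is optional and gives [1 + x]. *)
Lemma sum_supersets (R : comNzRingType) (E : finType) (U : {set E}) (x : R) :
  \sum_(s : {set E}) (U \subset s)%:R * x ^+ #|s|
  = x ^+ #|U| * (1 + x) ^+ (#|E| - #|U|).
Proof.
have -> : x ^+ #|U| * (1 + x) ^+ (#|E| - #|U|)
    = \prod_e (x + (e \notin U)%:R).
  rewrite (bigID [in U]) /= -(cardsC U) addKn; congr (_ * _).
    rewrite -prodr_const; apply: eq_bigr => e eU.
    by rewrite eU addr0.
  rewrite -prodr_const; apply: eq_big => [e|e]; first by rewrite inE.
  by rewrite inE => ->; rewrite addrC.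
rewrite bigA_distr; apply: eq_bigr => s _.
rewrite (bigID [in s]) /= mulrC; congr (_ * _).
  by rewrite -prodr_const; apply: eq_bigr => e ->.
(* The product of [e \notin U] over [e] outside [s] is the indicator of [U \subset s]. *)
have [/subsetP sUs | /subsetPn[e eU es]] := boolP (U \subset s).
  rewrite big1 // => e es; rewrite (negPf es).
  by rewrite (contra (sUs e) es).
by rewrite (bigD1 e) //= (negPf es) eU mul0r.
Qed.

Lemma int_theta_dvd (G : multigraph) :
  exists q : {poly int},
    int_theta G = q * (1 - 'X) ^+ (#|edge G| - #|vertex G|).
Proof.
pose w (i : vertex G) (o : option (edge G)) : {poly int} :=
  if o is Some e then - (((ends e).1 == i) + ((ends e).2 == i))%:R else 1.
pose U (f : {ffun vertex G -> option (edge G)}) : {set edge G} :=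
  [set e | Some e \in codom f].
(* Each vertex selects at most one edge. *)
have cardU f : (#|U f| <= #|vertex G|)%N.
  rewrite -(card_imset (mem (U f)) Some_inj) -(size_codom f).
  apply: leq_trans (card_size _); apply: subset_leq_card.
  by apply/subsetP => _ /imsetP[e + ->]; rewrite inE.
have expand (s : {set edge G}) :
    \prod_(i : vertex G) (1 - (degree s i)%:R)
    = \sum_(f : {ffun vertex G -> option (edge G)})
        (\prod_i w i (f i)) * (U f \subset s)%:R :> {poly int}.
  (* All dependence on [s] goes into [chi], so [f] ranges over a set independent of [s] and the two
     sums can be exchanged. *)
  pose chi (o : option (edge G)) := if o is Some e then e \in s else true.
  have -> : \prod_(i : vertex G) (1 - (degree s i)%:R)
      = \prod_i \sum_o w i o * (chi o)%:R :> {poly int}.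
    apply: eq_bigr => i _.
    rewrite (bigD1 None) //= mulr1; congr (_ + _).
    rewrite /degree natr_sum -sumrN big_mkcond.
    rewrite (reindex_omap Some id) /=; last by case.
    apply: eq_big => [e|e _]; first by rewrite eqxx.
    by case: ifP; rewrite ?mulr1 ?mulr0.
  rewrite bigA_distr_bigA; apply: eq_bigr => f _.
  rewrite big_split /=; congr (_ * _).
  have [/subsetP sUs | /subsetPn[e]] := boolP (U f \subset s).
    rewrite big1 // => i _; case Dfi: (f i) => [e|] //=.
    by rewrite sUs // inE -Dfi codom_f.
  rewrite inE => /codomP[i Dfi] es.
  by rewrite (bigD1 i) //= -Dfi /= (negPf es) mul0r.
(* By [cardU], [#|edge G| - #|U f|] is at least the truncated [#|edge G| - #|vertex G|], so that
   power factors out of every term. *)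
exists (\sum_(f : {ffun vertex G -> option (edge G)})
  (\prod_i w i (f i)) * ((- 'X) ^+ #|U f|
    * (1 - 'X) ^+ (#|edge G| - #|U f| - (#|edge G| - #|vertex G|)))).
rewrite /int_theta.
under eq_bigr => s _ do rewrite expand mulr_suml.
rewrite exchange_big mulr_suml; apply: eq_bigr => f _ /=.
under eq_bigr => s _ do rewrite -mulrA.
rewrite -mulr_sumr sum_supersets -!mulrA -exprD; congr (_ * (_ * _ ^+ _)).
by rewrite subnK // leq_sub2l.
Qed.

(** Reconciles truncated subtraction with the integer exponent: one of [m - n] and [n - m] is always
    0. *)
Lemma mulf_expr_subn (F : fieldType) (a x : F) (m n : nat) :
  x != 0 -> a * x ^+ (m - n) / x ^ (m%:Z - n%:Z) = a * x ^+ (n - m).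
Proof.
move=> x0; have [le_nm | /ltnW le_mn] := leqP n m.
  by rewrite subzn // -exprnP mulfK ?expf_neq0 // (eqP le_nm) mulr1.
by rewrite (eqP le_mn) mulr1 -opprB subzn // -exprnN invrK.
Qed.

Theorem theorem8 (C : numClosedFieldType) (G : multigraph)
    (hG : connected_graph G) :
  exists p : {poly int}, omega C G = tofrac (map_poly (intr : int -> C) p).
Proof.
have [q Dq] := int_theta_dvd G.
pose F := tofrac (1 - 'X : {poly C}).
have F0 : F != 0.
  by rewrite tofrac_eq0 -oppr_eq0 opprB polyXsubC_eq0.
have Dth : tofrac (theta G ('i : C))
    = tofrac (map_poly intr q) * F ^+ (#|edge G| - #|vertex G|).
  by rewrite theta_i_int Dq !rmorphM !rmorphXn /= rmorphB rmorph1 /= map_polyX.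
(* The extra factor is 1 unless there are fewer edges than vertices, where dividing by a negative
   power multiplies. *)
exists (q * (1 - 'X) ^+ (#|vertex G| - #|edge G|)).
rewrite /omega -/F Dth mulf_expr_subn // !rmorphM !rmorphXn /=.
by rewrite rmorphB rmorph1 /= map_polyX.
Qed.
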